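(* Suppose that $g$ is twice differentiable, that $Z^{*}(\xi_0)\neq\emptyset$, and that for every $k\ge0$: $\mathrm{P}(\xi_k)$ is strongly regular at $\bar z^k\in Z^{*}(\xi_k)$; $\|F'(\bar z^k)-\tilde F'_k\|\le\kappa$ with a constant $0\le\kappa<\frac1{2\gamma}$; and $\|F'(z)-F'(\bar z^k)\|\le\omega\|z-\bar z^k\|$ for all $z$ in a neighborhood $\mathcal{B}(\bar z^k,\rho_z)$, with a constant $0\le\omega<+\infty$. Then there are constants $0\le\alpha<1$, $0\le c_1,c_3<+\infty$, $0<c_2<+\infty$ such that the sequence $\{z^k\}$ generated by Algorithm APCSCP satisfies, for $z^k$ and $\xi_{k+1}$ in suitable neighborhoods $\mathcal{B}(\bar z^k,\rho_z)$ and $\mathcal{B}(\xi_k,\rho_\xi)$, $$\|z^{k+1}-\bar z^{k+1}\|\le(\alpha+c_1\|z^k-\bar z^k\|)\|z^k-\bar z^k\|+(c_2+c_3\|\xi_{k+1}-\xi_k\|)\|\xi_{k+1}-\xi_k\|,$$ and, with these constants, there exists a positive number $0<r_z<\bar r_z:=(1-\alpha)c_1^{-1}$ such that if the initial point $z^0$ of Algorithm APCSCP is chosen such that $\|z^0-\bar z^0\|\le r_z$, where $\bar z^0\in Z^{*}(\xi_0)$, then, for any $k\ge0$, $$\|z^{k+1}-\bar z^{k+1}\|\le r_z,$$ provided that $\|\xi_{k+1}-\xi_k\|\le r_\xi$ (for all $k$, with $\xi_{k+1}\in\mathcal{B}(\xi_k,\rho_\xi)$), where $\bar z^{k+1}\in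 Z^{*}(\xi_{k+1})$ and $0<r_\xi\le\bar r_\xi$ with $$\bar r_\xi:=\begin{cases}(2c_3)^{-1}\left[\sqrt{c_2^2+4c_3r_z(1-\alpha-c_1r_z)}-c_2\right]&\text{if }c_3>0,\\ c_2^{-1}r_z(1-\alpha-c_1r_z)&\text{if }c_3=0.\end{cases}$$ Consequently, the error sequence $\{e_k\}_{k\ge0}$, $e_k:=\|z^k-\bar z^k\|$, between the exact KKT point $\bar z^k$ and the approximate KKT point $z^k$ of $\mathrm{P}(\xi_k)$ is bounded.
   Context: Notation: $\|\cdot\|$ is the Euclidean norm (and the induced norm for matrices); $\mathcal{B}(x,r)$ is the open ball of radius $r$ centered at $x$; $\mathcal{S}^n_+$ is the set of real symmetric positive semidefinite $n\times n$ matrices; $g'$ is the Jacobian of $g$. If $c_1=0$, $\bar r_z$ is read as $+\infty$. Parametric problem. Let $c\in\mathbb{R}^n$, $g:\mathbb{R}^n\to\mathbb{R}^m$, $M\in\mathbb{R}^{m\times p}$, let $\Omega\subseteq\mathbb{R}^n$ be nonempty, closed and convex, and let $\mathcal{P}\subseteq\mathbb{R}^p$ be the parameter set, $\xi_k\in\mathcal{P}$. $\mathrm{P}(\xi)$ is: $\min_{x\in\mathbb{R}^n} c^Tx$ subject to $g(x)+M\xi=0$, $x\in\Omega$. Let $\mathcal{N}_\Omega(x)=\{u: u^T(x-v)\ge0\ \forall v\in\Omega\}$ if $x\in\Omega$ and $\emptyset$ otherwise be the normal cone. Put $K:=\Omega\times\mathbb{R}^m$, with normal cone $\mathcal{N}_K$,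 $z=(x,y)\in\mathbb{R}^{n}\times\mathbb{R}^m$, $$F(z):=\begin{pmatrix}c+g'(x)^Ty\\ g(x)\end{pmatrix},\qquad C:=\begin{bmatrix}0\\ M\end{bmatrix}.$$ A KKT point of $\mathrm{P}(\xi)$ is a $z$ with $0\in F(z)+C\xi+\mathcal{N}_K(z)$; $Z^{*}(\xi)$ is the set of KKT points. Strong regularity. For $\bar z^k\in Z^{*}(\xi_k)$ put $L(z;\bar z^k,\xi_k):=F(\bar z^k)+F'(\bar z^k)(z-\bar z^k)+C\xi_k+\mathcal{N}_K(z)$ and $L^{-1}(\delta;\bar z^k,\xi_k):=\{z:\delta\in L(z;\bar z^k,\xi_k)\}$. $\mathrm{P}(\xi_k)$ is strongly regular at $\bar z^k$ if there are balls $\mathcal{B}(0,\bar r_\delta)$ and $\mathcal{B}(\bar z^k,\bar r)$ such that $z^*_k(\delta):=\mathcal{B}(\bar z^k,\bar r)\cap L^{-1}(\delta;\bar z^k,\xi_k)$ is single-valued and Lipschitz continuous on $\mathcal{B}(0,\bar r_\delta)$ with Lipschitz constant $0<\gamma<+\infty$. The constants $\gamma,\bar r,\bar r_\delta$ do not depend on $k$. Subproblem. Given $z^k=(x^k,y^k)\in\Omega\times\mathbb{R}^m$, $A_k\in\mathbb{R}^{m\times n}$, $H_k\in\mathcal{S}^n_+$, let $m^k:=(g'(x^k)-A_k)^Ty^k$. The convex subproblem $\mathrm{P}(z^k,A_k,H_k;\xi)$ is: $\min_x\{c^Tx+(m^k)^T(x-x^k)+\frac12(x-x^k)^TH_k(x-x^k)\}$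 subject to $A_k(x-x^k)+g(x^k)+M\xi=0$, $x\in\Omega$. With $$\tilde F'_k:=\begin{bmatrix}H_k&A_k^T\\ A_k&0\end{bmatrix},$$ its KKT points are the $z$ with $0\in F(z^k)+\tilde F'_k(z-z^k)+C\xi+\mathcal{N}_K(z)$. The Slater condition $\mathrm{ri}(\Omega)\cap\{x: g(x^k)+A_k(x-x^k)+M\xi_{k+1}=0\}\ne\emptyset$ is assumed for the subproblems, so KKT points are exactly the pairs (solution, multiplier). Algorithm APCSCP. Start from $z^0=(x^0,y^0)$, an approximate KKT point of $\mathrm{P}(\xi_0)$, and matrices $A_0$ and $H_0\in\mathcal{S}^n_+$. At iteration $k=0,1,\dots$: get a new parameter $\xi_{k+1}\in\mathcal{P}$; let $z^{k+1}=(x^{k+1},y^{k+1})$ be the solution and the corresponding multiplier of $\mathrm{P}(z^k,A_k,H_k;\xi_{k+1})$; choose new matrices $A_{k+1}$ and $H_{k+1}\in\mathcal{S}^n_+$. Convention: $\bar z^{k+1}$ denotes the unique point of $Z^{*}(\xi_{k+1})$ in the neighborhood $\mathcal{B}(\bar z^k,\rho_z)$, for $\xi_{k+1}\in\mathcal{B}(\xi_k,\rho_\xi)$. The constants $\alpha,c_1,c_2,c_3,\kappa,\omega$ and the radii $\rho_z,\rho_\xi$ are the same for all $k$; $\rho_z$ may be taken as small as needed. *)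

(* Defs.v *)
From HB Require Import structures.
From mathcomp Require Import all_boot all_order all_algebra.
From mathcomp Require Import all_classical all_reals all_analysis.
Set Implicit Arguments.
Unset Strict Implicit.
Unset Printing Implicit Defensive.
Import Order.TTheory GRing.Theory Num.Theory.
Import numFieldNormedType.Exports.
Local Open Scope classical_set_scope.
Local Open Scope ring_scope.

Section Euclidean.
Variable R : realType.

Definition dotp n (u v : 'cV[R]_n) : R := (u^T *m v) 0 0.

(* The library norm `|v| on matrices is the max norm.  It induces the same
   topology, so the library's [closed] and [differentiable] are the usual ones,
   but all metric estimates below are Euclidean. *)
Definition enorm n (v : 'cV[R]_n) : R := Num.sqrt (dotp v v).

Definition eball n (x : 'cV[R]_n) (r : R) : set 'cV[R]_n :=
  [set v | enorm (v - x) < r].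

Definition opnorm m n (A : 'M[R]_(m, n)) : R :=
  sup [set enorm (A *m v) | v in [set v | enorm v <= 1]].

(* The library's [jacobian] is for row vectors and is the transpose of this. *)
Definition jac n m (f : 'cV[R]_n -> 'cV[R]_m) (x : 'cV[R]_n) : 'M[R]_(m, n) :=
  \matrix_(i, j) ('d f x (delta_mx j 0)) i 0.

Definition twice_differentiable n m (g : 'cV[R]_n -> 'cV[R]_m) : Prop :=
  (forall x, differentiable g x) /\ (forall x, differentiable (jac g) x).

Definition sym_psd n (H : 'M[R]_n) : Prop :=
  H^T = H /\ forall v : 'cV[R]_n, 0 <= dotp v (H *m v).

(* Empty when x is not in S. *)
Definition normal_cone n (S : set 'cV[R]_n) (x : 'cV[R]_n) : set 'cV[R]_n :=
  [set u | S x /\ forall v, S v -> 0 <= dotp u (x - v)].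

Definition affine_hull n (S : set 'cV[R]_n) : set 'cV[R]_n :=
  [set x | exists N (t : 'I_N -> R) (v : 'I_N -> 'cV[R]_n),
    [/\ forall i, S (v i), \sum_i t i = 1 & x = \sum_i t i *: v i]].

Definition relint n (S : set 'cV[R]_n) : set 'cV[R]_n :=
  [set x | S x /\ exists2 e : R, 0 < e & eball x e `&` affine_hull S `<=` S].

End Euclidean.

(* A pair z = (x, y) in R^n x R^m is the stacked vector [col_mx x y];
   x = usubmx z and y = dsubmx z. *)
Section Parametric.
Variables (R : realType) (n m p : nat).
Variables (c : 'cV[R]_n) (g : 'cV[R]_n -> 'cV[R]_m) (M : 'M[R]_(m, p)).
Variables (Omega : set 'cV[R]_n) (Par : set 'cV[R]_p).

Definition Kset : set 'cV[R]_(n + m) := [set z | Omega (usubmx z)].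

Definition Fmap (z : 'cV[R]_(n + m)) : 'cV[R]_(n + m) :=
  col_mx (c + (jac g (usubmx z))^T *m dsubmx z) (g (usubmx z)).

Definition Cmx : 'M[R]_(n + m, p) := col_mx 0 M.

Definition KKT_points (xi : 'cV[R]_p) : set 'cV[R]_(n + m) :=
  [set z | [set Fmap z + Cmx *m xi + u | u in normal_cone Kset z] 0].

Definition Lmap (zbar : 'cV[R]_(n + m)) (xi : 'cV[R]_p) (z : 'cV[R]_(n + m)) :
    set 'cV[R]_(n + m) :=
  [set Fmap zbar + jac Fmap zbar *m (z - zbar) + Cmx *m xi + u
     | u in normal_cone Kset z].

Definition Linv zbar xi (delta : 'cV[R]_(n + m)) : set 'cV[R]_(n + m) :=
  [set z | Lmap zbar xi z delta].

Definition strongly_regular (gamma r rdelta : R) zbar xi : Prop :=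
  exists zs : 'cV[R]_(n + m) -> 'cV[R]_(n + m),
    (forall d, eball 0 rdelta d -> eball zbar r `&` Linv zbar xi d = [set zs d])
    /\ (forall d d', eball 0 rdelta d -> eball 0 rdelta d' ->
          enorm (zs d - zs d') <= gamma * enorm (d - d')).

Section Subproblem.
Variables (zk : 'cV[R]_(n + m)) (A : 'M[R]_(m, n)) (H : 'M[R]_n).
Variable xi : 'cV[R]_p.
Let xk := usubmx zk.
Let yk := dsubmx zk.

Definition sub_lin : 'cV[R]_n := (jac g xk - A)^T *m yk.

Definition sub_obj (x : 'cV[R]_n) : R :=
  dotp c x + dotp sub_lin (x - xk) + 2^-1 * dotp (x - xk) (H *m (x - xk)).

Definition sub_feasible : set 'cV[R]_n :=
  [set x | A *m (x - xk) + g xk + M *m xi = 0 /\ Omega x].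

Definition sub_solution : set 'cV[R]_n :=
  [set x | sub_feasible x /\ forall v, sub_feasible v -> sub_obj x <= sub_obj v].

Definition sub_slater : Prop :=
  relint Omega `&` [set x | g xk + A *m (x - xk) + M *m xi = 0] !=set0.

Definition Ftilde : 'M[R]_(n + m) := block_mx H A^T A 0.

Definition sub_KKT_points : set 'cV[R]_(n + m) :=
  [set z | [set Fmap zk + Ftilde *m (z - zk) + Cmx *m xi + u
              | u in normal_cone Kset z] 0].

(* Under [sub_slater], y is a multiplier of the solution x exactly when (x, y)
   is a KKT point. *)
Definition sub_solution_multiplier : set 'cV[R]_(n + m) :=
  [set z | sub_solution (usubmx z) /\ sub_KKT_points z].

End Subproblem.

Record apcscp_run (xi : nat -> 'cV[R]_p) (A : nat -> 'M[R]_(m, n))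
    (H : nat -> 'M[R]_n) (z : nat -> 'cV[R]_(n + m)) : Prop := ApcscpRun {
  run_par : forall k, Par (xi k);
  run_psd : forall k, sym_psd (H k);
  run_init : Omega (usubmx (z 0%N));
  run_slater : forall k, sub_slater (z k) (A k) (xi k.+1);
  run_step : forall k,
    sub_solution_multiplier (z k) (A k) (H k) (xi k.+1) (z k.+1) }.

Record regular_path (gamma r rdelta kappa omega rho : R)
    (xi : nat -> 'cV[R]_p) (A : nat -> 'M[R]_(m, n)) (H : nat -> 'M[R]_n)
    (zbar : nat -> 'cV[R]_(n + m)) : Prop := RegularPath {
  path_KKT : forall k, KKT_points (xi k) (zbar k);
  path_regular : forall k, strongly_regular gamma r rdelta (zbar k) (xi k);
  path_approx : forall k,
    opnorm (jac Fmap (zbar k) - Ftilde (A k) (H k)) <= kappa;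
  path_lipschitz : forall k z, eball (zbar k) rho z ->
    opnorm (jac Fmap z - jac Fmap (zbar k)) <= omega * enorm (z - zbar k) }.

End Parametric.

Section Radii.
Variable R : realType.

Definition rbar_z (alpha c1 : R) : \bar R :=
  if c1 == 0 then +oo%E else ((1 - alpha) * c1^-1)%:E.

Definition rbar_xi (alpha c1 c2 c3 rz : R) : R :=
  if 0 < c3 then
    (2 * c3)^-1 *
      (Num.sqrt (c2 ^+ 2 + 4 * c3 * rz * (1 - alpha - c1 * rz)) - c2)
  else c2^-1 * rz * (1 - alpha - c1 * rz).

End Radii.

(* Main.v *)
Require Import Defs.
From HB Require Import structures.
From mathcomp Require Import all_boot all_order all_algebra.
From mathcomp Require Import all_classical all_reals all_analysis.
From mathcomp Require Import ring lra.
Set Implicit Arguments.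
Unset Strict Implicit.
Unset Printing Implicit Defensive.
Import Order.TTheory GRing.Theory Num.Theory.
Import numFieldNormedType.Exports.
Local Open Scope classical_set_scope.
Local Open Scope ring_scope.

(* Write e for the distance from z^k to zbar^k, x for the parameter increment
   and Phi for the composition of the Lipschitz localization z*_k with the
   residual of the system at hand.

   A KKT point of P(xi') near zbar^k is a fixed point of Phi for the residual of
   the perturbed KKT system, a contraction since F' is nearly constant near
   zbar^k; this gives existence, uniqueness and a drift of order x.  A KKT point
   of the subproblem near zbar^k is a fixed point of Phi for the residual of the
   subproblem, a contraction since gamma kappa < 1/2.  Strong regularity alone
   says nothing of KKT points far from zbar^k, but the subproblem is convex, so
   its KKT points form a convex set: a locally unique one is the only one.

   Comparing the two fixed points gives, with d the drift,
     (1 - gamma kappa) |z^{k+1} - zbar^{k+1}|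
       <= gamma kappa (e + d) + gamma omega (e + d)^2,
   hence the estimate with alpha = gamma kappa / (1 - gamma kappa) < 1.  The
   radius rbar_xi is the positive root of c3 x^2 + c2 x = rz (1 - alpha - c1 rz),
   so the ball of radius rz is invariant. *)

(** * Euclidean inner product, norm and induced matrix norm *)

Section EuclideanNorm.
Variable R : realType.

Lemma dotpE n (u v : 'cV[R]_n) : dotp u v = \sum_i u i 0 * v i 0.
Proof. by rewrite /dotp mxE; apply: eq_bigr => i _; rewrite mxE. Qed.

Lemma dotpC n (u v : 'cV[R]_n) : dotp u v = dotp v u.
Proof. by rewrite !dotpE; apply: eq_bigr => i _; rewrite mulrC. Qed.

Lemma dotpDr n (u v w : 'cV[R]_n) : dotp u (v + w) = dotp u v + dotp u w.
Proof. by rewrite /dotp mulmxDr mxE. Qed.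

Lemma dotpZr n a (u v : 'cV[R]_n) : dotp u (a *: v) = a * dotp u v.
Proof. by rewrite /dotp -scalemxAr mxE. Qed.

Lemma dotpNr n (u v : 'cV[R]_n) : dotp u (- v) = - dotp u v.
Proof. by rewrite -scaleN1r dotpZr mulN1r. Qed.

Lemma dotpBr n (u v w : 'cV[R]_n) : dotp u (v - w) = dotp u v - dotp u w.
Proof. by rewrite dotpDr dotpNr. Qed.

Lemma dotpDl n (u v w : 'cV[R]_n) : dotp (v + w) u = dotp v u + dotp w u.
Proof. by rewrite dotpC dotpDr !(dotpC u). Qed.

Lemma dotpZl n a (u v : 'cV[R]_n) : dotp (a *: v) u = a * dotp v u.
Proof. by rewrite dotpC dotpZr (dotpC u). Qed.

Lemma dotpNl n (u v : 'cV[R]_n) : dotp (- v) u = - dotp v u.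
Proof. by rewrite dotpC dotpNr (dotpC u). Qed.

Lemma dotpBl n (u v w : 'cV[R]_n) : dotp (v - w) u = dotp v u - dotp w u.
Proof. by rewrite dotpDl dotpNl. Qed.

Lemma dotp0r n (u : 'cV[R]_n) : dotp u 0 = 0.
Proof. by rewrite -(scale0r 0) dotpZr mul0r. Qed.

Lemma dotp0l n (u : 'cV[R]_n) : dotp 0 u = 0.
Proof. by rewrite dotpC dotp0r. Qed.

Lemma dotp_mulmx m n (A : 'M[R]_(m, n)) u v :
  dotp u (A *m v) = dotp (A^T *m u) v.
Proof. by rewrite /dotp trmx_mul trmxK mulmxA. Qed.

Lemma dotp_col_mx m n (u u' : 'cV[R]_m) (v v' : 'cV[R]_n) :
  dotp (col_mx u v) (col_mx u' v') = dotp u u' + dotp v v'.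
Proof. by rewrite /dotp tr_col_mx mul_row_col mxE. Qed.

Lemma dotp_ge0 n (v : 'cV[R]_n) : 0 <= dotp v v.
Proof. by rewrite dotpE sumr_ge0 // => i _; rewrite -expr2 sqr_ge0. Qed.

Lemma sqr_coord_le_dotp n (v : 'cV[R]_n) i : v i 0 ^+ 2 <= dotp v v.
Proof.
rewrite dotpE (bigD1 i) //= expr2 lerDl sumr_ge0 // => j _.
by rewrite -expr2 sqr_ge0.
Qed.

Lemma dotp_eq0 n (v : 'cV[R]_n) : dotp v v = 0 -> v = 0.
Proof.
move=> v0; apply/colP => i; rewrite mxE; apply/eqP.
by rewrite -sqrf_eq0 eq_le sqr_ge0 -{1}v0 sqr_coord_le_dotp.
Qed.

Lemma enorm_ge0 n (v : 'cV[R]_n) : 0 <= enorm v.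
Proof. exact: sqrtr_ge0. Qed.

Lemma sqr_enorm n (v : 'cV[R]_n) : enorm v ^+ 2 = dotp v v.
Proof. by rewrite sqr_sqrtr ?dotp_ge0. Qed.

Lemma enorm0 n : enorm (0 : 'cV[R]_n) = 0.
Proof. by rewrite /enorm dotp0r sqrtr0. Qed.

Lemma enorm0_eq0 n (v : 'cV[R]_n) : enorm v = 0 -> v = 0.
Proof. by move=> v0; apply: dotp_eq0; rewrite -sqr_enorm v0 expr0n. Qed.

Lemma enormZ n a (v : 'cV[R]_n) : enorm (a *: v) = `|a| * enorm v.
Proof.
by rewrite /enorm dotpZr dotpZl mulrA -expr2 sqrtrM ?sqr_ge0 // sqrtr_sqr.
Qed.

Lemma enormN n (v : 'cV[R]_n) : enorm (- v) = enorm v.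
Proof. by rewrite -scaleN1r enormZ normrN1 mul1r. Qed.

Lemma enormBC n (u v : 'cV[R]_n) : enorm (u - v) = enorm (v - u).
Proof. by rewrite -opprB enormN. Qed.

(** Cauchy-Schwarz: expanding the square of [enorm v *: u - enorm u *: v] gives twice
    [enorm u * enorm v] times the claimed gap. *)
Lemma dotp_le_enorm n (u v : 'cV[R]_n) : dotp u v <= enorm u * enorm v.
Proof.
have [v0|vN0] := eqVneq (enorm v) 0.
  by rewrite v0 mulr0 (enorm0_eq0 v0) dotp0r.
have [u0|uN0] := eqVneq (enorm u) 0.
  by rewrite u0 mul0r (enorm0_eq0 u0) dotp0l.
have v_gt0 : 0 < enorm v by rewrite lt_def vN0 enorm_ge0.
have u_gt0 : 0 < enorm u by rewrite lt_def uN0 enorm_ge0.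
have := dotp_ge0 (enorm v *: u - enorm u *: v).
rewrite !(dotpBl, dotpBr, dotpZl, dotpZr) (dotpC v u) -!sqr_enorm => h.
rewrite -subr_ge0 -(pmulr_rge0 _ (mulr_gt0 u_gt0 v_gt0)).
by rewrite -(pmulr_rge0 _ (ltr0Sn R 1)); apply: le_trans h _; lra.
Qed.

Lemma ler_enormD n (u v : 'cV[R]_n) : enorm (u + v) <= enorm u + enorm v.
Proof.
rewrite -(ler_pXn2r (ltn0Sn 1)) ?nnegrE ?addr_ge0 ?enorm_ge0 //.
rewrite sqrrD !sqr_enorm !(dotpDl, dotpDr) (dotpC v u).
have := dotp_le_enorm u v; lra.
Qed.

Lemma ler_enorm_dist n (w u v : 'cV[R]_n) :
  enorm (u - v) <= enorm (u - w) + enorm (w - v).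
Proof. by rewrite -(subrKA w u) ler_enormD. Qed.

Lemma coord_le_enorm n (v : 'cV[R]_n) i : `|v i 0| <= enorm v.
Proof.
rewrite -(ler_pXn2r (ltn0Sn 1)) ?nnegrE ?enorm_ge0 //.
by rewrite sqr_enorm real_normK ?num_real // sqr_coord_le_dotp.
Qed.

Lemma enorm_le_sum n (v : 'cV[R]_n) : enorm v <= \sum_i `|v i 0|.
Proof.
rewrite -(ler_pXn2r (ltn0Sn 1)) ?nnegrE ?enorm_ge0 ?sumr_ge0 //.
rewrite sqr_enorm dotpE expr2 mulr_suml; apply: ler_sum => i _.
apply: le_trans (ler_norm _) _; rewrite normrM ler_wpM2l //.
by rewrite (bigD1 i) //= lerDl sumr_ge0.
Qed.

(** A crude constant is enough: it shows that the supremum defining [opnorm] is taken over a bounded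
    set. *)
Lemma enorm_mulmx_ubound m n (A : 'M[R]_(m, n)) :
  exists2 K, 0 <= K & forall v, enorm (A *m v) <= K * enorm v.
Proof.
exists (\sum_i \sum_j `|A i j|) => [|v].
  by apply: sumr_ge0 => i _; apply: sumr_ge0.
apply: le_trans (enorm_le_sum _) _; rewrite mulr_suml ler_sum // => i _.
rewrite mxE; apply: le_trans (ler_norm_sum _ _ _) _.
rewrite mulr_suml ler_sum // => j _; rewrite normrM ler_wpM2l //.
exact: coord_le_enorm.
Qed.

Lemma opnorm_has_sup m n (A : 'M[R]_(m, n)) :
  has_sup [set enorm (A *m v) | v in [set v | enorm v <= 1]].
Proof.
split; first by exists (enorm (A *m 0)), 0 => //=; rewrite enorm0.
have [K K0 HK] := enorm_mulmx_ubound A; exists K => _ [v /= v1 <-].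
by apply: le_trans (HK v) _; rewrite ler_piMr.
Qed.

Lemma opnorm_ge0 m n (A : 'M[R]_(m, n)) : 0 <= opnorm A.
Proof.
have [_ hub] := opnorm_has_sup A.
by apply: (ub_le_sup hub); exists 0; rewrite /= ?mulmx0 enorm0.
Qed.

Lemma enorm_mulmx_le m n (A : 'M[R]_(m, n)) v :
  enorm (A *m v) <= opnorm A * enorm v.
Proof.
have [v0|vN0] := eqVneq (enorm v) 0.
  by rewrite v0 mulr0 (enorm0_eq0 v0) mulmx0 enorm0.
have v_gt0 : 0 < enorm v by rewrite lt_def vN0 enorm_ge0.
rewrite -ler_pdivrMr // mulrC -[X in X * _]gtr0_norm ?invr_gt0 //.
rewrite -enormZ scalemxAr; have [_ hub] := opnorm_has_sup A.
apply: (ub_le_sup hub); exists ((enorm v)^-1 *: v) => //=.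
by rewrite enormZ gtr0_norm ?invr_gt0 // mulVf.
Qed.

End EuclideanNorm.

(** * Contraction principle on a closed Euclidean ball *)

Section EuclideanFixedPoint.
Variable R : realType.

(** The sequence is its first term plus a telescoping series dominated by a geometric one. *)
Lemma geometric_increments_cvg (a : nat -> R) d q :
  0 <= d -> 0 <= q < 1 -> (forall k, `|a k.+1 - a k| <= d * q ^+ k) ->
  cvgn a.
Proof.
move=> d0 /andP[q0 q1] ha.
have sc : cvgn (series (telescope a)).
  apply: normed_cvg; apply: (series_le_cvg (v_ := geometric d q)) => //.
  - by move=> k; apply: normr_ge0.
  - by move=> k; apply: mulr_ge0 => //; apply: exprn_ge0.
  - by apply: is_cvg_geometric_series; rewrite ger0_norm.
rewrite (_ : a = cst (a 0%N) \+ series (telescope a)).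
  by apply: is_cvgD => //; exact: is_cvg_cst.
by apply/funext => k /=; rewrite -eq_sum_telescope.
Qed.

(** The iterates from the centre have geometric increments, so each coordinate converges; summing
    over the finitely many coordinates gives convergence in [enorm]. *)
Lemma enorm_fixed_point n (f : 'cV[R]_n -> 'cV[R]_n) (c : 'cV[R]_n) s q :
  0 <= s -> 0 <= q < 1 ->
  (forall u, enorm (u - c) <= s -> enorm (f u - c) <= s) ->
  (forall u v, enorm (u - c) <= s -> enorm (v - c) <= s ->
    enorm (f u - f v) <= q * enorm (u - v)) ->
  exists2 u, enorm (u - c) <= s & f u = u.
Proof.
move=> s0 q01 fs fq; pose u k := iter k f c.
have [q0 q1] := andP q01.
have us k : enorm (u k - c) <= s.
  by elim: k => [|k /fs //]; rewrite subrr enorm0.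
have uq k : enorm (u k.+1 - u k) <= enorm (f c - c) * q ^+ k.
  elim: k => [|k IH]; first by rewrite mulr1.
  apply: le_trans (fq (u k.+1) (u k) (us _) (us _)) _.
  by rewrite exprS mulrCA ler_wpM2l.
have ucvg i : cvgn (fun k => u k i 0).
  apply: (geometric_increments_cvg (enorm_ge0 (f c - c)) q01) => k.
  apply: le_trans (uq k); apply: le_trans (coord_le_enorm _ i).
  by rewrite !mxE.
pose l : 'cV[R]_n := \col_i limn (fun k => u k i 0).
have ul e : 0 < e -> \forall k \near \oo, enorm (u k - l) <= e.
  move=> e0.
  (* The n coordinate errors add up to at most [e * n / n.+1]; the successor keeps the threshold
     meaningful when n = 0. *)
  have : \forall k \near \oo, forall i, `|u k i 0 - l i 0| < e / n.+1%:R.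
    apply: filter_forall => i; rewrite mxE.
    have /cvgrPdist_lt/(_ (e / n.+1%:R)) := ucvg i.
    by rewrite divr_gt0 // => /(_ isT); apply: filterS => k; rewrite distrC.
  apply: filterS => k hk; apply: le_trans (enorm_le_sum _) _.
  apply: (@le_trans _ _ (\sum_(i < n) e / n.+1%:R)).
    by apply: ler_sum => i _; have := hk i; rewrite !mxE => /ltW.
  rewrite sumr_const card_ord -[_ *+ n]mulr_natr -mulrA mulrC.
  rewrite -[leRHS]mul1r ler_wpM2r ?(ltW e0) // ler_pdivrMl ?ltr0Sn // mulr1.
  by rewrite ler_nat.
have lc : enorm (l - c) <= s.
  apply/ler_addgt0Pr => e e0.
  have [k _ /(_ k (leqnn k)) hk] := ul _ e0.
  apply: le_trans (ler_enorm_dist (u k) _ _) _.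
  by rewrite addrC lerD // enormBC.
exists l => //; apply/subr0_eq/enorm0_eq0/eqP.
rewrite eq_le enorm_ge0 andbT; apply/ler_addgt0Pr => e e0; rewrite add0r.
(* Both [u k] and [u k.+1 = f (u k)] are within e / 2 of [l], and [f] does not increase the first
   distance. *)
have [k _ hk] := ul _ (divr_gt0 e0 (ltr0Sn R 1)).
have /= hk0 := hk k (leqnn k); have /= hk1 := hk k.+1 (leqnSn k).
apply: le_trans (ler_enorm_dist (u k.+1) _ _) _.
rewrite [e]splitr lerD //.
apply: le_trans (fq l (u k) lc (us _)) _.
rewrite enormBC -[leRHS]mul1r ler_pM ?enorm_ge0 ?(ltW q1) //.
Qed.

End EuclideanFixedPoint.

(** * Differentiability of vector maps and a mean value inequality *)

Section Differentiability.
Variable R : realType.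

Lemma differentiable_sumr (V W : normedModType R) n (f : 'I_n -> V -> W) x :
  (forall i, differentiable (f i) x) ->
  differentiable (fun v => \sum_(i < n) f i v) x.
Proof.
move=> /differentiable_sum df.
rewrite (_ : (fun _ => _) = \sum_(i < n) f i) //.
by apply/funext => v; rewrite fct_sumE.
Qed.

Lemma linear_col_differentiable (V : normedModType R) n
  (f : {linear 'cV[R]_n -> V}) x : differentiable f x.
Proof.
rewrite (_ : (f : _ -> _) =
  fun v : 'cV[R]_n => \sum_i v i 0 *: f (delta_mx i 0)).
  apply: differentiable_sumr => i; apply: differentiableZl.
  exact: differentiable_coord.
apply/funext => v; rewrite {1}[v]matrix_sum_delta linear_sum.
by apply: eq_bigr => i _; rewrite big_ord1 linearZ.
Qed.

Lemma diff_linear_col (V : normedModType R) n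
  (f : {linear 'cV[R]_n -> V}) x : 'd f x = f :> (_ -> _).
Proof.
apply: diff_lin => v.
exact/differentiable_continuous/linear_col_differentiable.
Qed.

Lemma differentiable_col (V : normedModType R) n (f : V -> 'cV[R]_n) x :
  (forall i, differentiable (fun v => f v i 0) x) -> differentiable f x.
Proof.
move=> df.
rewrite (_ : f = fun v => \sum_i f v i 0 *: (delta_mx i 0 : 'cV[R]_n)).
  by apply: differentiable_sumr => i; apply: differentiableZl.
apply/funext => v; rewrite {1}[f v]matrix_sum_delta.
by apply: eq_bigr => i _; rewrite big_ord1.
Qed.

Lemma jac_mulmx n m (f : 'cV[R]_n -> 'cV[R]_m) x v :
  jac f x *m v = 'd f x v.
Proof.
rewrite {2}[v]matrix_sum_delta linear_sum; apply/colP => i.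
rewrite mxE summxE; apply: eq_bigr => j _.
by rewrite big_ord1 linearZ !mxE mulrC.
Qed.

Lemma dotp_line_is_derive n m (f : 'cV[R]_n -> 'cV[R]_m) u z h t :
  differentiable f (z + t *: h) ->
  is_derive t 1 (fun s => dotp u (f (z + s *: h)))
    (dotp u (jac f (z + t *: h) *m h)).
Proof.
move=> df.
have dotp_lin : linear (dotp u).
  by move=> a v w; rewrite dotpDr dotpZr.
pose L : {linear 'cV[R]_m -> R^o} :=
  HB.pack (dotp u : 'cV[R]_m -> R^o) (GRing.isLinear.Build _ _ _ _ _ dotp_lin).
have dl : is_diff t (fun s : R => z + s *: h) (fun s => 0 + s *: h).
  exact: (is_diffD (is_diff_cst z t) (is_diff_scalel t h)).
have dL : is_diff (f (z + t *: h)) L L.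
  by apply: DiffDef; [exact: linear_col_differentiable|exact: diff_linear_col].
have dfl : is_diff (z + t *: h) f ('d f (z + t *: h)) by apply: DiffDef.
have dc : is_diff t (L \o (f \o (fun s : R => z + s *: h)))
   (L \o ('d f (z + t *: h) \o (fun s => 0 + s *: h))).
  exact: is_diff_comp.
have dcd : differentiable (L \o (f \o (fun s : R => z + s *: h))) t.
  exact: ex_diff.
apply: DeriveDef; first exact: diff_derivable.
by rewrite deriveE // diff_val /= add0r scale1r jac_mulmx.
Qed.

(** The scalar mean value theorem applies once [f] is paired with the error [u] itself along the
    segment: this writes [enorm u ^+ 2] as the product of [u] with [(jac f - B) *m h] at one
    intermediate point. *)
Lemma enorm_mean_value_le n m (f : 'cV[R]_n -> 'cV[R]_m) (B : 'M[R]_(m, n))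
    lam z w :
  (forall x, differentiable f x) ->
  (forall t, 0 <= t <= 1 -> opnorm (jac f (z + t *: (w - z)) - B) <= lam) ->
  enorm (f w - f z - B *m (w - z)) <= lam * enorm (w - z).
Proof.
move=> df hB; set h := w - z; set u := _ - B *m h.
(* When the error vanishes, nonnegativity of [lam] is still required; it is read off at t = 0. *)
have [u0|uN0] := eqVneq (enorm u) 0.
  rewrite u0 mulr_ge0 ?enorm_ge0 //; apply: le_trans (opnorm_ge0 _) (hB 0 _).
  by rewrite lexx ler01.
pose phi (t : R) : R := dotp u (f (z + t *: h)).
pose dphi (t : R) : R := dotp u (jac f (z + t *: h) *m h).
have dp (t : R) : is_derive t 1 phi (dphi t) by apply: dotp_line_is_derive.
have cphi : continuous phi.
  by move=> t; apply/differentiable_continuous/derivable1_diffP.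
have [t t01] := MVT_segment ler01 (fun t _ => dp t) (continuous_subspaceT cphi).
rewrite /phi /dphi scale1r scale0r addr0 [z + h]addrC subrK subr0 mulr1 => e.
have hu : enorm u ^+ 2 = dotp u ((jac f (z + t *: h) - B) *m h).
  by rewrite mulmxBl dotpBr -e -dotpBr -dotpBr sqr_enorm.
have u_gt0 : 0 < enorm u by rewrite lt_def uN0 enorm_ge0.
rewrite -(ler_pM2l u_gt0) -expr2 hu.
apply: le_trans (dotp_le_enorm _ _) _; rewrite ler_pM2l //.
apply: le_trans (enorm_mulmx_le _ _) _; rewrite ler_wpM2r ?enorm_ge0 //.
by apply: hB; move: t01; rewrite in_itv.
Qed.

(** The upper block contains the Jacobian of [g], so the second derivative of [g] enters here. *)
Lemma Fmap_differentiable n m (c : 'cV[R]_n) (g : 'cV[R]_n -> 'cV[R]_m) z :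
  twice_differentiable g -> differentiable (Fmap c g) z.
Proof.
move=> [dg djg].
have du : differentiable (usubmx : 'cV[R]_(n + m) -> _) z.
  by apply: linear_col_differentiable.
apply: differentiable_col => i; case: (split_ordP i) => j ->.
- rewrite (_ : (fun _ => _) = cst (c j 0) + fun v : 'cV[R]_(n + m) =>
    \sum_i jac g (usubmx v) i j * v (rshift n i) 0).
    apply: differentiableD => //; apply: differentiable_sumr => k.
    apply: (@differentiableM _ _ (fun v => jac g (usubmx v) k j)
      (fun v : 'cV[R]_(n + m) => v (rshift n k) 0));
      last exact: differentiable_coord.
    apply: (@differentiable_comp _ _ _ _ (jac g \o usubmx)
      (fun N : 'M[R]_(m, n) => N k j)); last exact: differentiable_coord.
    by apply: differentiable_comp.
  apply/funext => v; rewrite /Fmap col_mxEu !mxE; congr (_ + _).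
  by apply: eq_bigr => k _; rewrite !mxE.
- rewrite (_ : (fun _ => _) = (fun N : 'cV[R]_m => N j 0) \o (g \o usubmx)).
    apply: differentiable_comp; last exact: differentiable_coord.
    exact: differentiable_comp.
  by apply/funext => v; rewrite /Fmap col_mxEd.
Qed.

End Differentiability.

(** * Normal cones and convexity of the KKT set of the subproblem *)

Section GeneralizedEquations.
Variables (R : realType) (n m p : nat).
Variables (c : 'cV[R]_n) (g : 'cV[R]_n -> 'cV[R]_m) (M : 'M[R]_(m, p)).
Variable Omega : set 'cV[R]_n.
Local Notation F := (Fmap c g).
Local Notation C := (Cmx n M).
Local Notation V := 'cV[R]_(n + m).

Lemma image_addl (W : zmodType) (a d : W) (S : set W) :
  [set a + u | u in S] d <-> S (d - a).
Proof.
split=> [[u Su <-]|Sd]; first by rewrite [a + u]addrC addrK.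
by exists (d - a) => //; rewrite addrC subrK.
Qed.

Lemma convex_set_segment (S : set 'cV[R]_n) x y t :
  convex_set S -> S x -> S y -> 0 <= t <= 1 -> S (x + t *: (y - x)).
Proof.
move=> Sconv Sx Sy /andP[t0 t1].
have -> : x + t *: (y - x) = t *: y + (1 - t) *: x.
  by rewrite scalerBl scale1r scalerBr addrCA.
exact: set_mem (Sconv y x (Itv01 t0 t1) (mem_set Sy) (mem_set Sx)).
Qed.

(** The multiplier block is unconstrained in K, so [z] may be moved along the multiplier part of [u]
    itself, which forces that part to have norm zero. *)
Lemma normal_cone_Kset_dsubmx (z u : V) :
  normal_cone (Kset Omega) z u -> dsubmx u = 0.
Proof.
move=> [Kz hu]; apply: dotp_eq0; apply/eqP; rewrite eq_le dotp_ge0 andbT.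
have /hu : Kset Omega (z + col_mx 0 (dsubmx u)).
  by rewrite /Kset /= linearD /= col_mxKu addr0.
rewrite opprD addNKr dotpNr oppr_ge0 -{1}[u]vsubmxK dotp_col_mx dotp0r add0r.
by [].
Qed.

Lemma sub_KKT_pointsP zk A H xi z :
  sub_KKT_points c g M Omega zk A H xi z <->
  normal_cone (Kset Omega) z (- (F zk + Ftilde A H *m (z - zk) + C *m xi)).
Proof. by rewrite -[X in normal_cone _ _ X]sub0r; exact: image_addl. Qed.

(* The solutions of a monotone generalized equation form a convex set.  For two
   KKT points with difference h, feasibility gives A h_x = 0, so only the
   monotone part H of Ftilde acts on h, and <Ftilde h, h> vanishes. *)
Lemma sub_KKT_points_segment zk A H xi z1 z2 t :
  convex_set Omega -> sym_psd H -> 0 <= t <= 1 ->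
  sub_KKT_points c g M Omega zk A H xi z1 ->
  sub_KKT_points c g M Omega zk A H xi z2 ->
  sub_KKT_points c g M Omega zk A H xi (z1 + t *: (z2 - z1)).
Proof.
move=> Oconv [HT Hpsd] t01 /sub_KKT_pointsP N1 /sub_KKT_pointsP N2.
apply/sub_KKT_pointsP; set B := Ftilde A H in N1 N2 *.
set w1 := F zk + _ + _ in N1; set h := z2 - z1.
have wE v : F zk + B *m (z1 + v - zk) + C *m xi = w1 + B *m v.
  by rewrite /w1 (addrAC z1 v) mulmxDr addrA [RHS]addrAC.
rewrite wE -scalemxAr.
have w2E : F zk + B *m (z2 - zk) + C *m xi = w1 + B *m h.
  by rewrite -wE /h [z1 + _]addrC subrK.
rewrite w2E in N2.
have [K1 h1] := N1; have [K2 h2] := N2.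
have Ah : A *m usubmx h = 0.
  have d1 := normal_cone_Kset_dsubmx N1.
  have := normal_cone_Kset_dsubmx N2; rewrite opprD linearD /= d1 add0r.
  rewrite linearN /= => /eqP; rewrite oppr_eq0 => /eqP.
  by rewrite /B /Ftilde -{1}[h]vsubmxK mul_block_col mul0mx addr0 col_mxKd.
have BhE : dotp (B *m h) h = dotp (usubmx h) (H *m usubmx h).
  rewrite /B /Ftilde -[h]vsubmxK mul_block_col mul0mx addr0 dotp_col_mx.
  rewrite !col_mxKu Ah dotp0l addr0 dotpDl -dotp_mulmx.
  by rewrite Ah dotp0r addr0 dotpC.
(* Nonnegative because [H] is positive semidefinite; nonpositive by adding the two normal cone
   inequalities, each tested at the other point. *)
have Bh0 : dotp (B *m h) h = 0.
  apply/eqP; rewrite eq_le {2}BhE Hpsd andbT.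
  have := h1 _ K2; have := h2 _ K1; rewrite -/h -[z1 - z2]opprB -/h.
  rewrite !(dotpNl, dotpNr) dotpDl; lra.
split=> [|v Kv].
  by rewrite /Kset /= linearD linearZ linearB /=; apply: convex_set_segment.
(* With [Bh0] the quadratic term in t disappears, so the goal is the combination with weights 1 - t
   and t of the inequalities at [z1] and [z2]. *)
have := h1 _ Kv; have := h2 _ Kv.
have -> : z2 - v = (z1 - v) + h by rewrite [_ + h]addrC subrKA.
rewrite (addrAC z1 (t *: h)) !(dotpNl, dotpDl, dotpZl).
rewrite !(dotpDr _ _ h, dotpDr _ _ (t *: h), dotpZr) Bh0.
have /andP[t0 t1] := t01; rewrite -subr_ge0 in t1.
by move=> /(mulr_ge0 t0) hb /(mulr_ge0 t1) ha; lra.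
Qed.

End GeneralizedEquations.

(** * Local analysis at a strongly regular KKT point *)

Section StrongRegularity.
Variables (R : realType) (n m p : nat).
Variables (c : 'cV[R]_n) (g : 'cV[R]_n -> 'cV[R]_m) (M : 'M[R]_(m, p)).
Variable Omega : set 'cV[R]_n.
Hypotheses (Omega_convex : convex_set Omega) (g_twice : twice_differentiable g).
Variables (gamma r rdelta kappa omega rho rhoz rhoxi : R).
Hypotheses (gamma_gt0 : 0 < gamma) (omega_ge0 : 0 <= omega).
Hypotheses (kappa_ge0 : 0 <= kappa) (kappa_lt : gamma * kappa < 2^-1).
Variables (zbar : 'cV[R]_(n + m)) (xi : 'cV[R]_p).
Local Notation F := (Fmap c g).
Local Notation C := (Cmx n M).
Local Notation V := 'cV[R]_(n + m).
Local Notation J := (jac F zbar).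
Hypothesis zbar_KKT : KKT_points c g M Omega xi zbar.
Hypothesis zbar_regular : strongly_regular c g M Omega gamma r rdelta zbar xi.
Hypothesis J_lipschitz : forall z, eball zbar rho z ->
  opnorm (jac F z - J) <= omega * enorm (z - zbar).

Lemma LinvP d z : Linv c g M Omega zbar xi d z <->
  normal_cone (Kset Omega) z (d - (F zbar + J *m (z - zbar) + C *m xi)).
Proof. exact: image_addl. Qed.

Lemma zbar_Linv0 : Linv c g M Omega zbar xi 0 zbar.
Proof.
apply/LinvP; rewrite subrr mulmx0 addr0.
by move: zbar_KKT => /image_addl.
Qed.

(** Single-valuedness identifies any two localized solutions with values of the Lipschitz selection,
    so later estimates need not mention the selection. *)
Lemma Linv_lipschitz d d' z z' :
  eball 0 rdelta d -> eball 0 rdelta d' -> eball zbar r z -> eball zbar r z' ->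
  Linv c g M Omega zbar xi d z -> Linv c g M Omega zbar xi d' z' ->
  enorm (z - z') <= gamma * enorm (d - d').
Proof.
have [zs [zsE zsL]] := zbar_regular => bd bd' bz bz' Lz Lz'.
have -> : z = zs d by have : [set zs d] z by rewrite -zsE.
have -> : z' = zs d' by have : [set zs d'] z' by rewrite -zsE.
exact: zsL.
Qed.

(** Composing the selection [zs] with [delta] gives a contraction of factor [gamma * lam]; its fixed
    points solve the linearized equation with residual depending on the solution. *)
Lemma Linv_fixed_point (delta : V -> V) s lam :
  0 <= s < r -> 0 <= lam -> gamma * lam < 1 ->
  (forall z, enorm (z - zbar) <= s ->
    enorm (delta z) < rdelta /\ gamma * enorm (delta z) <= s) ->
  (forall z z', enorm (z - zbar) <= s -> enorm (z' - zbar) <= s ->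
    enorm (delta z - delta z') <= lam * enorm (z - z')) ->
  exists2 z, enorm (z - zbar) <= s & Linv c g M Omega zbar xi (delta z) z.
Proof.
move=> /andP[s0 sr] lam0 lam1 hs hL.
have [zs [zsE zsL]] := zbar_regular.
have bd z : enorm (z - zbar) <= s -> eball 0 rdelta (delta z).
  by move=> /hs[? _]; rewrite /eball /= subr0.
have b0 : eball 0 rdelta (0 : V).
  rewrite /eball /= subr0 enorm0; apply: le_lt_trans (enorm_ge0 (delta zbar)) _.
  by have [] := hs zbar; rewrite ?subrr ?enorm0.
(* Anchoring the selection at [zbar] reduces invariance of the ball to
   [gamma * enorm (delta z) <= s]. *)
have zs0 : zs 0 = zbar.
  suff : [set zs 0] zbar by [].
  rewrite -zsE //; split; last exact: zbar_Linv0.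
  by rewrite /eball /= subrr enorm0 (le_lt_trans s0).
have gl01 : 0 <= gamma * lam < 1 by rewrite mulr_ge0 // ltW.
have [||z zs1 zE] := @enorm_fixed_point _ _ (zs \o delta) zbar s _ s0 gl01.
- move=> u us /=; rewrite -zs0; apply: le_trans (zsL _ _ (bd _ us) b0) _.
  by rewrite subr0; have [] := hs _ us.
- move=> u v us vs /=; apply: le_trans (zsL _ _ (bd _ us) (bd _ vs)) _.
  by rewrite -mulrA ler_wpM2l ?(ltW gamma_gt0) // hL.
exists z => //.
suff : (eball zbar r `&` Linv c g M Omega zbar xi (delta z)) z by case.
by rewrite zsE; [rewrite /= -[LHS]zE|exact: bd].
Qed.

(** The segment stays in the closed ball of radius [s] about [zbar], where the Jacobian differs from
    [J] by at most [omega * s]. *)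
Lemma Fmap_linearization_error s z z' :
  s < rho -> enorm (z - zbar) <= s -> enorm (z' - zbar) <= s ->
  enorm (F z' - F z - J *m (z' - z)) <= omega * s * enorm (z' - z).
Proof.
move=> srho zs zs'; apply: enorm_mean_value_le.
  by move=> x; apply: Fmap_differentiable.
move=> t /andP[t0 t1].
have ht : enorm (z + t *: (z' - z) - zbar) <= s.
  have -> : z + t *: (z' - z) - zbar = (1 - t) *: (z - zbar) + t *: (z' - zbar).
    by apply/colP => i; rewrite !mxE; ring.
  apply: le_trans (ler_enormD _ _) _; rewrite !enormZ.
  rewrite !ger0_norm ?subr_ge0 //.
  rewrite [leRHS](_ : _ = (1 - t) * s + t * s); last by ring.
  by rewrite lerD // ler_wpM2l ?subr_ge0.
apply: le_trans (J_lipschitz _) _; last by rewrite ler_wpM2l.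
exact: le_lt_trans srho.
Qed.

(* Residuals in the linearized generalized equation at zbar of a solution of,
   respectively, the perturbed KKT system and the KKT system of the subproblem. *)
Definition residual xi' (z : V) : V :=
  F zbar + J *m (z - zbar) - F z + C *m (xi - xi').

Definition sub_residual (zk : V) (B : 'M[R]_(n + m)) xi' (z : V) : V :=
  F zbar + J *m (z - zbar) - F zk - B *m (z - zk) + C *m (xi - xi').

Lemma KKT_Linv xi' z : KKT_points c g M Omega xi' z <->
  Linv c g M Omega zbar xi (residual xi' z) z.
Proof.
apply: iff_trans (iff_sym (LinvP _ _)).
have -> : residual xi' z - (F zbar + J *m (z - zbar) + C *m xi) =
    0 - (F z + C *m xi').
  rewrite /residual (mulmxBr C); set a := F zbar + _; set b := C *m xi.
  set d := C *m _.
  by apply/colP => i; rewrite !mxE; ring.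
exact: image_addl.
Qed.

Lemma sub_KKT_Linv zk A H xi' z : sub_KKT_points c g M Omega zk A H xi' z <->
  Linv c g M Omega zbar xi (sub_residual zk (Ftilde A H) xi' z) z.
Proof.
apply: iff_trans (iff_sym (LinvP _ _)).
set B := Ftilde A H.
have -> : sub_residual zk B xi' z - (F zbar + J *m (z - zbar) + C *m xi) =
    0 - (F zk + B *m (z - zk) + C *m xi').
  rewrite /sub_residual (mulmxBr C); set a := F zbar + _; set b := C *m xi.
  set d := B *m _; set e := C *m xi'.
  by apply/colP => i; rewrite !mxE; ring.
exact: image_addl.
Qed.

(** The factor 3 leaves strict room for the radii up to 5/2 [rhoz] used below and for residuals with
    [gamma] times norm up to 9/4 [rhoz]. The last two conditions bound [gamma * omega * rhoz] by 1/4
    and [gamma * opnorm C * rhoxi] by [rhoz] / 4. *)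
Hypotheses (rhoz_gt0 : 0 < rhoz) (rhoz_rho : 3 * rhoz <= rho).
Hypotheses (rhoz_r : 3 * rhoz <= r) (rhoz_rdelta : 3 * rhoz <= gamma * rdelta).
Hypothesis rhoz_omega : 4 * gamma * omega * rhoz <= 1.
Hypothesis rhoxi_small : 4 * gamma * opnorm C * rhoxi <= rhoz.

Lemma residual_lipschitz xi' z z' :
  enorm (z - zbar) <= rhoz -> enorm (z' - zbar) <= rhoz ->
  enorm (residual xi' z - residual xi' z') <= omega * rhoz * enorm (z - z').
Proof.
move=> hz hz'; rewrite -enormN.
have -> : - (residual xi' z - residual xi' z') = F z - F z' - J *m (z - z').
  have -> : z - z' = (z - zbar) - (z' - zbar).
    by apply/colP => i; rewrite !mxE; ring.
  rewrite /residual (mulmxBr J (z - zbar)).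
  set a := J *m _; set b := J *m _; set d := C *m _.
  by apply/colP => i; rewrite !mxE; ring.
apply: Fmap_linearization_error => //.
by apply: lt_le_trans rhoz_rho; have := rhoz_gt0; lra.
Qed.

Lemma residual_le xi' z : enorm (z - zbar) <= rhoz ->
  enorm (residual xi' z) <=
    omega * rhoz * enorm (z - zbar) + opnorm C * enorm (xi' - xi).
Proof.
move=> hz; rewrite -[residual xi' z](subrK (residual xi' zbar)).
apply: le_trans (ler_enormD _ _) _; apply: lerD.
  by apply: residual_lipschitz => //; rewrite subrr enorm0 ltW.
rewrite /residual subrr mulmx0 addr0 subrr add0r enormBC.
exact: enorm_mulmx_le.
Qed.

Lemma residual_small xi' z : enorm (xi' - xi) < rhoxi ->
  enorm (z - zbar) <= rhoz ->
  gamma * enorm (residual xi' z) <= 4^-1 * enorm (z - zbar) + 4^-1 * rhoz /\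
  enorm (residual xi' z) < rdelta.
Proof.
move=> hxi hz; have := residual_le xi' hz.
have e0 := enorm_ge0 (z - zbar); have x0 := enorm_ge0 (xi' - xi).
move=> /(ler_wpM2l (ltW gamma_gt0)) h.
have h1 : gamma * enorm (residual xi' z) <=
    4^-1 * enorm (z - zbar) + 4^-1 * rhoz.
  apply: le_trans h _; rewrite mulrDr; apply: lerD.
    rewrite !mulrA; apply: ler_wpM2r => //.
    by move: rhoz_omega; rewrite -!mulrA; lra.
  have := ler_wpM2l (mulr_ge0 (ltW gamma_gt0) (opnorm_ge0 C)) (ltW hxi).
  by move: rhoxi_small; rewrite -!mulrA; lra.
split=> //; rewrite -(ltr_pM2l gamma_gt0).
apply: lt_le_trans rhoz_rdelta; apply: le_lt_trans h1 _.
by have := rhoz_gt0; lra.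
Qed.

Lemma eball_rhoz_r z : enorm (z - zbar) <= 5/2 * rhoz -> eball zbar r z.
Proof.
move=> hz; rewrite /eball /=; apply: lt_le_trans rhoz_r.
by have := rhoz_gt0; lra.
Qed.

Lemma KKT_points_dist xi' z xi'' z' :
  enorm (xi' - xi) < rhoxi -> enorm (xi'' - xi) < rhoxi ->
  enorm (z - zbar) <= rhoz -> enorm (z' - zbar) <= rhoz ->
  KKT_points c g M Omega xi' z -> KKT_points c g M Omega xi'' z' ->
  enorm (z - z') <= gamma * enorm (residual xi' z - residual xi'' z').
Proof.
move=> hxi hxi' hz hz' /KKT_Linv Lz /KKT_Linv Lz'.
apply: (Linv_lipschitz _ _ _ _ Lz Lz').
- by rewrite /eball /= subr0; have [] := residual_small hxi hz.
- by rewrite /eball /= subr0; have [] := residual_small hxi' hz'.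
- by apply: eball_rhoz_r; have := rhoz_gt0; lra.
- by apply: eball_rhoz_r; have := rhoz_gt0; lra.
Qed.

Lemma KKT_points_near_unique xi' : eball xi rhoxi xi' ->
  exists! z, KKT_points c g M Omega xi' z /\ eball zbar rhoz z.
Proof.
move=> hxi; have gw : gamma * (omega * rhoz) < 1.
  by move: rhoz_omega; rewrite -!mulrA; lra.
(* Half the radius is invariant, since 1/8 + 1/4 <= 1/2, and puts the solution inside the open ball
   of radius [rhoz], where uniqueness is then proved. *)
have [|||||z zs Lz] :=
  @Linv_fixed_point (residual xi') (2^-1 * rhoz) (omega * rhoz).
- by apply/andP; split; move: rhoz_r rhoz_gt0; lra.
- by rewrite mulr_ge0 // ltW.
- by [].
- move=> z hz; have hz1 : enorm (z - zbar) <= rhoz by move: rhoz_gt0; lra.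
  have [h1 h2] := residual_small hxi hz1; split=> //.
  by move: rhoz_gt0; lra.
- by move=> z z' hz hz'; apply: residual_lipschitz; move: rhoz_gt0; lra.
have hz1 : enorm (z - zbar) < rhoz by move: rhoz_gt0; lra.
exists z; split; first by split=> //; apply/KKT_Linv.
move=> z' [Kz' hz']; apply/subr0_eq/enorm0_eq0/eqP.
rewrite eq_le enorm_ge0 andbT leNgt; apply/negP => zz'.
have Kz : KKT_points c g M Omega xi' z by apply/KKT_Linv.
have := KKT_points_dist hxi hxi (ltW hz1) (ltW hz') Kz Kz'.
move=> /le_trans /(_ (ler_wpM2l (ltW gamma_gt0)
  (residual_lipschitz xi' (ltW hz1) (ltW hz')))).
by rewrite mulrA leNgt gtr_pMl // gw.
Qed.

(** * One step of the algorithm *)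

Section Subproblem.
Variables (zk : V) (A : 'M[R]_(m, n)) (H : 'M[R]_n) (xi' : 'cV[R]_p).
Local Notation B := (Ftilde A H).
Local Notation sres := (sub_residual zk B xi').
Local Notation e := (enorm (zk - zbar)).
Local Notation x := (enorm (xi' - xi)).
Hypotheses (zk_near : eball zbar rhoz zk) (xi'_near : eball xi rhoxi xi').
Hypotheses (H_psd : sym_psd H) (B_approx : opnorm (J - B) <= kappa).

Lemma sub_residual_lipschitz z z' :
  enorm (sres z - sres z') <= kappa * enorm (z - z').
Proof.
have -> : sres z - sres z' = (J - B) *m (z - z').
  have -> : z - z' = (z - zbar) - (z' - zbar).
    by apply/colP => i; rewrite !mxE; ring.
  rewrite mulmxBl !(mulmxBr J (z - zbar)) (_ : z - zbar - (z' - zbar) =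
    (z - zk) - (z' - zk)); last by apply/colP => i; rewrite !mxE; ring.
  rewrite (mulmxBr B (z - zk)) /sub_residual.
  set a := J *m _; set b := J *m _; set d := B *m _; set f := B *m _.
  by set h := C *m _; apply/colP => i; rewrite !mxE; ring.
by apply: le_trans (enorm_mulmx_le _ _) _; rewrite ler_wpM2r ?enorm_ge0.
Qed.

(* The radius 5/2 rhoz leaves room to leave the ball of radius 2 rhoz, where a
   KKT point is found, towards another KKT point. *)
Lemma sub_residual_small z : enorm (z - zbar) <= 5/2 * rhoz ->
  gamma * enorm (sres z) <= rhoz + 2^-1 * enorm (z - zbar) /\
  enorm (sres z) < rdelta.
Proof.
move=> hz; have hx : x < rhoxi by [].
have he : e < rhoz by [].
have hxi := ler_wpM2l (mulr_ge0 (ltW gamma_gt0) (opnorm_ge0 C)) (ltW hx).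
have e0 := enorm_ge0 (zk - zbar); have z0 := enorm_ge0 (z - zbar).
have h0 : enorm (sres z) <= omega * rhoz * e + kappa * enorm (z - zk) +
    opnorm C * x.
  have -> : sres z = (F zbar - F zk - J *m (zbar - zk)) + (J - B) *m (z - zk) +
      C *m (xi - xi').
    rewrite /sub_residual mulmxBl (_ : z - zbar = (z - zk) - (zbar - zk));
      last by apply/colP => i; rewrite !mxE; ring.
    rewrite (mulmxBr J (z - zk)).
    set a := J *m _; set b := J *m _; set d := B *m _; set f := C *m _.
    by apply/colP => i; rewrite !mxE; ring.
  apply: le_trans (ler_enormD _ _) _; apply: lerD; last first.
    by rewrite [x]enormBC; exact: enorm_mulmx_le.
  apply: le_trans (ler_enormD _ _) _; apply: lerD.
  - rewrite [e]enormBC; apply: Fmap_linearization_error; last 2 first.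
    + exact: ltW.
    + by rewrite subrr enorm0 ltW.
    + by move: rhoz_rho rhoz_gt0; lra.
  - by apply: le_trans (enorm_mulmx_le _ _) _; rewrite ler_wpM2r ?enorm_ge0.
(* The linearization error contributes e / 4, the matrix error half of [enorm (z - zbar) + e], the
   parameter shift [rhoz] / 4; then e < [rhoz]. *)
have h1 : gamma * enorm (sres z) <= rhoz + 2^-1 * enorm (z - zbar).
  apply: le_trans (ler_wpM2l (ltW gamma_gt0) h0) _.
  have hk : gamma * (kappa * enorm (z - zk)) <= 2^-1 * (enorm (z - zbar) + e).
    rewrite mulrA; apply: ler_pM;
      rewrite ?enorm_ge0 ?mulr_ge0 //; try exact: ltW.
    by have := ler_enorm_dist zbar z zk; rewrite (enormBC zbar).
  have ho : gamma * (omega * rhoz * e) <= 4^-1 * e.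
    by rewrite !mulrA ler_wpM2r //; move: rhoz_omega; rewrite -!mulrA; lra.
  by move: rhoxi_small hxi; rewrite !mulrDr -!mulrA; lra.
split=> //; rewrite -(ltr_pM2l gamma_gt0).
by apply: lt_le_trans rhoz_rdelta; apply: le_lt_trans h1 _; move: rhoz_gt0; lra.
Qed.

Lemma sub_KKT_near_unique z z' :
  enorm (z - zbar) <= 5/2 * rhoz -> enorm (z' - zbar) <= 5/2 * rhoz ->
  sub_KKT_points c g M Omega zk A H xi' z ->
  sub_KKT_points c g M Omega zk A H xi' z' -> z = z'.
Proof.
move=> hz hz' /sub_KKT_Linv Lz /sub_KKT_Linv Lz'.
have : enorm (z - z') <= gamma * enorm (sres z - sres z').
  apply: (Linv_lipschitz _ _ _ _ Lz Lz').
  - by rewrite /eball /= subr0; have [] := sub_residual_small hz.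
  - by rewrite /eball /= subr0; have [] := sub_residual_small hz'.
  - exact: eball_rhoz_r.
  - exact: eball_rhoz_r.
move=> /le_trans/(_ (ler_wpM2l (ltW gamma_gt0) (sub_residual_lipschitz z z'))).
rewrite mulrA => h; apply/subr0_eq/enorm0_eq0/eqP.
rewrite eq_le enorm_ge0 andbT leNgt; apply/negP => zz'.
by move: h; rewrite leNgt gtr_pMl // (lt_trans kappa_lt) // invf_lt1 ?ltr1n.
Qed.

(** A fixed point [z0] exists in the ball of radius 2 [rhoz], the radius s solving [rhoz] + s / 2 =
    s. A point slightly off [z0] on the segment to [z] is also a KKT point, so local uniqueness
    makes it equal to [z0], however far [z] might be. *)
Lemma sub_KKT_near z : sub_KKT_points c g M Omega zk A H xi' z ->
  enorm (z - zbar) <= 2 * rhoz.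
Proof.
move=> Kz.
have [|||||z0 z0s Lz0] := @Linv_fixed_point sres (2 * rhoz) kappa.
- by apply/andP; split; move: rhoz_r rhoz_gt0; lra.
- by [].
- by rewrite (lt_trans kappa_lt) // invf_lt1 ?ltr1n.
- move=> w hw; have hw1 : enorm (w - zbar) <= 5/2 * rhoz by move: rhoz_gt0; lra.
  by have [h1 h2] := sub_residual_small hw1; split=> //; lra.
- by move=> w w' _ _; apply: sub_residual_lipschitz.
have Kz0 : sub_KKT_points c g M Omega zk A H xi' z0 by apply/sub_KKT_Linv.
suff -> : z = z0 by [].
set h := z - z0; have h0 : 0 <= enorm h := enorm_ge0 h.
have hr : 0 < enorm h + rhoz by rewrite ltr_wpDl.
(* This makes [t * enorm h] less than [rhoz] / 2, so the new point stays within 5/2 [rhoz]; adding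
   [rhoz] in the denominator covers h = 0 and gives t <= 1. *)
pose t := rhoz / 2 / (enorm h + rhoz).
have t0 : 0 < t by rewrite /t !divr_gt0.
have th : t * (enorm h + rhoz) = rhoz / 2 by rewrite /t mulfVK // gt_eqF.
have t1 : t <= 1 by rewrite /t ler_pdivrMr // mul1r; move: rhoz_gt0; lra.
have tr := mulr_gt0 t0 rhoz_gt0.
have t01 : 0 <= t <= 1 by rewrite (ltW t0).
have Kt := sub_KKT_points_segment Omega_convex H_psd t01 Kz0 Kz.
have z0t : z0 = z0 + t *: h.
  apply: sub_KKT_near_unique Kz0 Kt; first by move: rhoz_gt0; lra.
  rewrite addrAC; apply: le_trans (ler_enormD _ _) _.
  by rewrite enormZ gtr0_norm //; move: th; rewrite mulrDr; lra.
apply/subr0_eq/eqP; rewrite -/h.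
have : t *: h = 0 by apply: (addrI z0); rewrite addr0 -z0t.
by move/eqP; rewrite scaler_eq0 gt_eqF.
Qed.

Variables (zbar' z : V).
Hypotheses (zbar'_KKT : KKT_points c g M Omega xi' zbar').
Hypothesis zbar'_near : eball zbar rhoz zbar'.
Hypothesis z_KKT : sub_KKT_points c g M Omega zk A H xi' z.
Local Notation d := (enorm (zbar' - zbar)).

(** [zbar] has zero residual at [xi]. The term d / 4 is absorbed on the left, leaving the factor
    4/3, rounded up to 2. *)
Lemma KKT_drift : d <= 2 * gamma * opnorm C * x.
Proof.
have d0 := enorm_ge0 (zbar' - zbar); have x0 := enorm_ge0 (xi' - xi).
have hd : d <= rhoz by apply: ltW.
have : d <= gamma * enorm (residual xi' zbar' - residual xi zbar).
  apply: KKT_points_dist => //; rewrite ?subrr ?enorm0 //; last exact: ltW.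
  exact: le_lt_trans x0 xi'_near.
have -> : residual xi zbar = 0 by rewrite /residual !subrr !mulmx0 !addr0 subrr.
rewrite subr0 => h; have := residual_le xi' hd.
move=> /(ler_wpM2l (ltW gamma_gt0)) /(le_trans h); rewrite mulrDr => h'.
have h1 : gamma * (omega * rhoz * d) <= 4^-1 * d.
  by rewrite !mulrA ler_wpM2r //; move: rhoz_omega; rewrite -!mulrA; lra.
have := mulr_ge0 (mulr_ge0 (ltW gamma_gt0) (opnorm_ge0 C)) x0.
by move: h' h1; rewrite -!mulrA; lra.
Qed.

(** Both points solve the system linearized at [zbar], and their residuals share the parameter term,
    which cancels. What remains is the matrix error on [z - zbar'], absorbed on the left, the
    linearization error between [zk] and [zbar'], and the matrix error on that same difference. *)
Lemma subproblem_error :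
  (1 - gamma * kappa) * enorm (z - zbar') <=
    gamma * kappa * (e + d) + gamma * omega * (e + d) ^+ 2.
Proof.
have d0 := enorm_ge0 (zbar' - zbar); have e0 := enorm_ge0 (zk - zbar).
have hd : d < rhoz by []. have he : e < rhoz by [].
have hz := sub_KKT_near z_KKT.
have hz1 : enorm (z - zbar) <= 5/2 * rhoz by move: rhoz_gt0; lra.
have Dle : enorm (zbar' - zk) <= e + d.
  by rewrite [e]enormBC [leRHS]addrC ler_enorm_dist.
have h1 : enorm (z - zbar') <= gamma * enorm (sres z - residual xi' zbar').
  apply: (@Linv_lipschitz (sres z) (residual xi' zbar') z zbar').
  - by rewrite /eball /= subr0; have [] := sub_residual_small hz1.
  - by rewrite /eball /= subr0; have [] := residual_small xi'_near (ltW hd).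
  - exact: eball_rhoz_r.
  - by apply: eball_rhoz_r; move: rhoz_gt0; lra.
  - exact/sub_KKT_Linv.
  - exact/KKT_Linv.
have h2 : enorm (sres z - residual xi' zbar') <=
    kappa * enorm (z - zbar') + omega * (e + d) * (e + d) + kappa * (e + d).
  have -> : sres z - residual xi' zbar' = (J - B) *m (z - zbar') +
      (F zbar' - F zk - J *m (zbar' - zk)) + (J - B) *m (zbar' - zk).
    rewrite /sub_residual /residual !mulmxBl.
    have -> : J *m (zbar' - zbar) = J *m (z - zbar) - J *m (z - zbar').
      by rewrite -mulmxBr; congr (_ *m _); apply/colP => i; rewrite !mxE; ring.
    have -> : B *m (z - zk) = B *m (z - zbar') + B *m (zbar' - zk).
      by rewrite -mulmxDr subrKA.
    set a1 := J *m (z - zbar); set a2 := J *m (z - zbar').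
    set a3 := J *m (zbar' - zk); set b1 := B *m (z - zbar').
    set b2 := B *m (zbar' - zk); set k := C *m _.
    by apply/colP => i; rewrite !mxE; ring.
  apply: le_trans (ler_enormD _ _) _; apply: lerD.
    apply: le_trans (ler_enormD _ _) _; apply: lerD.
      by apply: le_trans (enorm_mulmx_le _ _) _; rewrite ler_wpM2r ?enorm_ge0.
    apply: le_trans (@Fmap_linearization_error (e + d) zk zbar' _ _ _) _.
    - by move: rhoz_rho rhoz_gt0; lra.
    - by rewrite lerDl.
    - by rewrite lerDr.
    - by rewrite ler_wpM2l // mulr_ge0 // addr_ge0.
  apply: le_trans (enorm_mulmx_le _ _) _.
  by apply: ler_pM; rewrite ?enorm_ge0 ?opnorm_ge0.
have := le_trans h1 (ler_wpM2l (ltW gamma_gt0) h2).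
by rewrite expr2; lra.
Qed.

Lemma apcscp_error_bound (alpha c0 c1 : R) :
  alpha = gamma * kappa / (1 - gamma * kappa) ->
  c0 = 2 * gamma * opnorm C ->
  c1 = 2 * gamma * omega / (1 - gamma * kappa) ->
  enorm (z - zbar') <=
    (alpha + c1 * e) * e + (alpha * c0 + 1 + c1 * c0 ^+ 2 * x) * x.
Proof.
move=> alphaE c0E c1E.
have q_gt0 : 0 < 1 - gamma * kappa by have := kappa_lt; lra.
have d0 := enorm_ge0 (zbar' - zbar); have e0 := enorm_ge0 (zk - zbar).
have x0 := enorm_ge0 (xi' - xi).
have dx : d <= c0 * x by rewrite c0E; exact: KKT_drift.
have alpha0 : 0 <= alpha by rewrite alphaE divr_ge0 ?mulr_ge0 // ltW.
have c1_0 : 0 <= c1 by rewrite c1E divr_ge0 ?mulr_ge0 // ltW.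
have h : enorm (z - zbar') <= alpha * (e + d) + c1 / 2 * (e + d) ^+ 2.
  rewrite -(ler_pM2l q_gt0); apply: le_trans subproblem_error _.
  rewrite le_eqVlt; apply/orP; left; apply/eqP.
  by rewrite alphaE c1E; field; rewrite gt_eqF.
apply: le_trans h _.
(* The factor 2 in [c1] pays for separating e from d in the square. *)
have ed : c1 / 2 * (e + d) ^+ 2 <= c1 * e ^+ 2 + c1 * d ^+ 2.
  by rewrite -subr_ge0 (_ : _ - _ = c1 / 2 * (e - d) ^+ 2);
    [rewrite mulr_ge0 ?sqr_ge0 // divr_ge0|field].
have d2 : c1 * d ^+ 2 <= c1 * (c0 * x) ^+ 2.
  by rewrite ler_wpM2l // ler_pXn2r // nnegrE // (le_trans d0).
have := ler_wpM2l alpha0 dx; move: ed d2; lra.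
Qed.

End Subproblem.

End StrongRegularity.

(** For positive [c3], isolate the root, square, cancel [c2 ^+ 2] and divide by [4 * c3]. The sign
    condition on [rz * (1 - alpha - c1 * rz)] keeps the radicand nonnegative, so that the square
    root is a genuine one. *)
Lemma rbar_xi_step (R : realType) (alpha c1 c2 c3 rz rxi : R) :
  0 < c2 -> 0 <= c3 -> 0 <= rz * (1 - alpha - c1 * rz) ->
  0 < rxi <= rbar_xi alpha c1 c2 c3 rz ->
  (alpha + c1 * rz) * rz + (c2 + c3 * rxi) * rxi <= rz.
Proof.
move=> c2_gt0 c3_ge0 b_ge0 /andP[rxi_gt0]; rewrite /rbar_xi.
case: ltP => [c3_gt0|c3_le0].
  rewrite ler_pdivlMl ?mulr_gt0 // lerBrDr => h.
  have l_ge0 : 0 <= 2 * c3 * rxi + c2 by rewrite addr_ge0 ?mulr_ge0 // ltW.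
  have := h; rewrite -(ler_pXn2r (ltn0Sn 1)) ?nnegrE ?sqrtr_ge0 //.
  rewrite sqr_sqrtr; last first.
    rewrite addr_ge0 ?sqr_ge0 // -mulrA mulr_ge0 // mulr_ge0 //.
  move=> h2; rewrite -subr_ge0 -(pmulr_rge0 _ c3_gt0).
  by move: h2; rewrite !expr2; lra.
have -> : c3 = 0 by apply/eqP; rewrite eq_le c3_le0.
by rewrite mul0r addr0 -mulrA ler_pdivlMl // => h; lra.
Qed.

(** * Choice of constants and invariance of the ball of radius [rz] *)

Theorem corollary3p5 (R : realType) (n m p : nat)
  (c : 'cV[R]_n) (g : 'cV[R]_n -> 'cV[R]_m) (M : 'M[R]_(m, p))
  (Omega : set 'cV[R]_n) (Par : set 'cV[R]_p)
  (Omega_nonempty : Omega !=set0) (Omega_closed : closed Omega)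
  (Omega_convex : convex_set Omega)
  (g_twice : twice_differentiable g)
  (xi0 : 'cV[R]_p) (xi0_par : Par xi0)
  (KKT_nonempty : KKT_points c g M Omega xi0 !=set0)
  (gamma r rdelta kappa omega rho : R)
  (gamma_gt0 : 0 < gamma) (r_gt0 : 0 < r) (rdelta_gt0 : 0 < rdelta)
  (kappa_ge0 : 0 <= kappa) (kappa_lt : kappa < 1 / (2 * gamma))
  (omega_ge0 : 0 <= omega) (rho_gt0 : 0 < rho) :
  exists alpha c1 c2 c3 rhoz rhoxi : R,
    [/\ 0 <= alpha < 1, 0 <= c1, 0 < c2 & 0 <= c3] /\
    (0 < rhoz <= rho /\ 0 < rhoxi) /\
    (forall (xi : nat -> 'cV[R]_p) (A : nat -> 'M[R]_(m, n))
        (H : nat -> 'M[R]_n) (z zbar : nat -> 'cV[R]_(n + m)),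
      xi 0%N = xi0 ->
      apcscp_run c g M Omega Par xi A H z ->
      regular_path c g M Omega gamma r rdelta kappa omega rho xi A H zbar ->
      forall k,
        (forall xi', Par xi' -> eball (xi k) rhoxi xi' ->
          exists! z', KKT_points c g M Omega xi' z' /\ eball (zbar k) rhoz z') /\
        (eball (zbar k) rhoz (z k) ->
         eball (xi k) rhoxi (xi k.+1) ->
         eball (zbar k) rhoz (zbar k.+1) ->
         enorm (z k.+1 - zbar k.+1) <=
           (alpha + c1 * enorm (z k - zbar k)) * enorm (z k - zbar k) +
           (c2 + c3 * enorm (xi k.+1 - xi k)) * enorm (xi k.+1 - xi k))) /\
    exists rz : R,
      0 < rz /\ (rz%:E < rbar_z alpha c1)%E /\
      forall rxi : R, 0 < rxi <= rbar_xi alpha c1 c2 c3 rz ->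
      forall (xi : nat -> 'cV[R]_p) (A : nat -> 'M[R]_(m, n))
        (H : nat -> 'M[R]_n) (z zbar : nat -> 'cV[R]_(n + m)),
      xi 0%N = xi0 ->
      apcscp_run c g M Omega Par xi A H z ->
      regular_path c g M Omega gamma r rdelta kappa omega rho xi A H zbar ->
      enorm (z 0%N - zbar 0%N) <= rz ->
      (forall k, enorm (xi k.+1 - xi k) <= rxi) ->
      (forall k, eball (xi k) rhoxi (xi k.+1)) ->
      (forall k, eball (zbar k) rhoz (zbar k.+1)) ->
      (forall k, enorm (z k.+1 - zbar k.+1) <= rz) /\
      exists B : R, forall k, enorm (z k - zbar k) <= B.
Proof.
have gk : gamma * kappa < 2^-1.
  have g2 : 0 < 2 * gamma by rewrite mulr_gt0.
  by move: kappa_lt; rewrite ltr_pdivlMr //; lra.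
have gk0 : 0 <= gamma * kappa by rewrite mulr_ge0 // ltW.
have q_gt0 : 0 < 1 - gamma * kappa by lra.
have C0 : 0 <= opnorm (Cmx n M) := opnorm_ge0 _.
(* This quotient is below 1 precisely because [gamma * kappa] is below 1/2. *)
pose alpha := gamma * kappa / (1 - gamma * kappa).
pose c0 := 2 * gamma * opnorm (Cmx n M).
pose c1 := 2 * gamma * omega / (1 - gamma * kappa).
(* The added 1 keeps [c2] strictly positive when [alpha * c0] vanishes. *)
pose c2 := alpha * c0 + 1.
pose c3 := c1 * c0 ^+ 2.
(* One entry for each smallness condition on the radius; the + 1 in the denominators here and in
   [rhoxi] covers [omega] = 0 and a zero parameter matrix. *)
pose rhoz := Num.min (Num.min (rho / 3) (r / 3))
  (Num.min (gamma * rdelta / 3) (4 * gamma * omega + 1)^-1).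
pose rhoxi := rhoz / (4 * gamma * opnorm (Cmx n M) + 1).
have gw0 : 0 <= 4 * gamma * omega by rewrite !mulr_ge0 // ltW.
have gC0 : 0 <= 4 * gamma * opnorm (Cmx n M) by rewrite !mulr_ge0 // ltW.
have alpha0 : 0 <= alpha by rewrite divr_ge0 // ltW.
have alpha1 : alpha < 1 by rewrite ltr_pdivrMr // mul1r; lra.
have c0_0 : 0 <= c0 by rewrite !mulr_ge0 // ltW.
have c1_0 : 0 <= c1 by rewrite divr_ge0 ?mulr_ge0 // ltW.
have c2_0 : 0 < c2 by rewrite ltr_wpDl // mulr_ge0.
have c3_0 : 0 <= c3 by rewrite mulr_ge0 // sqr_ge0.
have rhoz_gt0 : 0 < rhoz.
  by rewrite !lt_min !divr_gt0 ?mulr_gt0 // invr_gt0 ltr_wpDl.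
have [h1 h2 h3 h4] : [/\ rhoz <= rho / 3, rhoz <= r / 3,
    rhoz <= gamma * rdelta / 3 & rhoz <= (4 * gamma * omega + 1)^-1].
  by split; rewrite !ge_min lexx ?orbT.
have rhoz_rho : 3 * rhoz <= rho by lra.
have rhoz_r : 3 * rhoz <= r by lra.
have rhoz_rdelta : 3 * rhoz <= gamma * rdelta by lra.
have rhoz_omega : 4 * gamma * omega * rhoz <= 1.
  move: h4; rewrite -[_^-1]mul1r ler_pdivlMr ?ltr_wpDl //.
  by rewrite mulrDr mulr1 mulrC; lra.
have rhoxi_gt0 : 0 < rhoxi by rewrite divr_gt0 // ltr_wpDl.
have rhoxi_small : 4 * gamma * opnorm (Cmx n M) * rhoxi <= rhoz.
  have : rhoxi * (4 * gamma * opnorm (Cmx n M) + 1) = rhoz.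
    by rewrite mulfVK // gt_eqF // ltr_wpDl.
  by rewrite mulrDr mulr1 mulrC; lra.
have estimate xi A H z zbar k :
    apcscp_run c g M Omega Par xi A H z ->
    regular_path c g M Omega gamma r rdelta kappa omega rho xi A H zbar ->
    eball (zbar k) rhoz (z k) -> eball (xi k) rhoxi (xi k.+1) ->
    eball (zbar k) rhoz (zbar k.+1) ->
    enorm (z k.+1 - zbar k.+1) <=
      (alpha + c1 * enorm (z k - zbar k)) * enorm (z k - zbar k) +
      (c2 + c3 * enorm (xi k.+1 - xi k)) * enorm (xi k.+1 - xi k).
  move=> run path zk xik zbark.
  exact: (apcscp_error_bound Omega_convex g_twice gamma_gt0 omega_ge0 kappa_ge0
    gk (path_KKT path k) (path_regular path k) (path_lipschitz path (k := k))
    rhoz_gt0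
    rhoz_rho rhoz_r rhoz_rdelta rhoz_omega rhoxi_small zk xik (run_psd run k)
    (path_approx path k) (path_KKT path k.+1) zbark (proj2 (run_step run k))
    (erefl alpha) (erefl c0) (erefl c1)).
exists alpha, c1, c2, c3, rhoz, rhoxi; split; first by rewrite alpha0.
split; first by rewrite rhoz_gt0 rhoxi_gt0; split=> //; lra.
split.
  move=> xi A H z zbar _ run path k; split; last exact: estimate run path.
  move=> xi' _ xi'_near.
  exact: (KKT_points_near_unique g_twice gamma_gt0 omega_ge0
    (path_KKT path k) (path_regular path k) (path_lipschitz path (k := k))
    rhoz_gt0
    rhoz_rho rhoz_r rhoz_rdelta rhoz_omega rhoxi_small xi'_near).
have c1S : 0 < c1 + 1 by rewrite ltr_wpDl.
(* The first entry keeps the iterates where the estimate holds; the second gives [c1 * rz] <= (1 -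
   [alpha]) / 2, also when [c1] = 0. *)
pose rz := Num.min (rhoz / 2) ((1 - alpha) / 2 / (c1 + 1)).
have rz_gt0 : 0 < rz by rewrite lt_min !divr_gt0 // subr_gt0.
have rz_rhoz : rz < rhoz.
  by rewrite gt_min; apply/orP; left; lra.
have c1rz : c1 * rz < 1 - alpha.
  have : rz <= (1 - alpha) / 2 / (c1 + 1) by rewrite ge_min lexx orbT.
  by rewrite ler_pdivlMr // mulrDr mulr1 mulrC; lra.
exists rz; split=> //; split.
  rewrite /rbar_z; case: eqP => [_|/eqP c1N0]; first exact: ltry.
  have c1_gt0 : 0 < c1 by rewrite lt_def c1N0.
  by rewrite lte_fin ltr_pdivlMr // mulrC.
move=> rxi rxi_le xi A H z zbar _ run path z0 xik xi_near zbar_near.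
have step k : enorm (z k - zbar k) <= rz -> enorm (z k.+1 - zbar k.+1) <= rz.
  move=> zk; apply: le_trans (estimate _ _ _ _ _ k run path _ _ _) _ => //.
    exact: le_lt_trans rz_rhoz.
  (* The estimate is monotone in both distances, so they may be replaced by [rz] and [rxi]. *)
  apply: le_trans (rbar_xi_step c2_0 c3_0 _ rxi_le); last first.
    by rewrite mulr_ge0 // ?ltW //; lra.
  have e0 := enorm_ge0 (z k - zbar k); have x0 := enorm_ge0 (xi k.+1 - xi k).
  apply: lerD; apply: ler_pM => //.
  - by rewrite addr_ge0 // mulr_ge0.
  - by rewrite lerD2l ler_wpM2l.
  - by rewrite addr_ge0 ?(ltW c2_0) // mulr_ge0.
  - by rewrite lerD2l ler_wpM2l.
have bound k : enorm (z k - zbar k) <= rz by elim: k => // k /step.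
by split; last exists rz.
Qed.
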